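(* Let $C=\{x\in\mathbb{R}^3: |x_i|\le 1 \text{ for all } 1\le i\le 3\}$ be the cube and let $O=\mathrm{conv}\{e_1,e_2,e_3,-e_1,-e_2,-e_3\}\subset\mathbb{R}^3$ be the octahedron, where $e_1,e_2,e_3$ are the standard basis vectors. Let $\nu_C$ and $\nu_O$ denote the Nieuwland numbers of $C$ and $O$ respectively. Then $$\nu_C=\nu_O.$$
   Context: A convex polytope in $\mathbb{R}^3$ is the convex hull of finitely many points, with non-empty interior. For $\eta\in\mathbb{R}^3\setminus\{0\}$, $\mathrm{proj}_\eta$ denotes the orthogonal projection of $\mathbb{R}^3$ onto the plane through the origin orthogonal to $\eta$; for $\eta=0$, $\mathrm{proj}_0$ is the identity. For convex polytopes $P,Q\subset\mathbb{R}^3$, $P$ passes through $Q$ if there exist $U\in SO(3)$, $\eta\in\mathbb{R}^3$, $\delta\in\mathbb{R}^3$ such that $\mathrm{proj}_\eta(UP+\delta)\subseteq \mathrm{proj}_\eta(Q)$. The Nieuwland number $\nu_P$ of a convex polytope $P$ is the supremum of all $\nu\ge 1$ such that $\nu P$ passes through $P$. *)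

(* Defs.v *)
From mathcomp Require Import all_boot all_order all_algebra.
From mathcomp Require Import all_classical all_reals all_analysis.

Set Implicit Arguments.
Unset Strict Implicit.
Unset Printing Implicit Defensive.

Import Order.TTheory GRing.Theory Num.Theory.

Local Open Scope classical_set_scope.
Local Open Scope ring_scope.

(* Points of R^n are column vectors. *)
Definition dotv (R : realType) (n : nat) (x y : 'cV[R]_n) : R :=
  \sum_(i < n) x i 0 * y i 0.

Definition special_orthogonal (R : realType) (n : nat) : set 'M[R]_n :=
  [set U | U *m U^T = 1%:M /\ \det U = 1].

Definition orth_proj (R : realType) (eta x : 'cV[R]_3) : 'cV[R]_3 :=
  if eta == 0 then x else x - (dotv x eta / dotv eta eta) *: eta.

(* [smallest F A] is the intersection of all members of [F] containing [A]. *)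
Definition convex_hull (R : realType) (n : nat) (A : set 'cV[R]_n) :
    set 'cV[R]_n :=
  smallest (@convex_set R 'cV[R]_n) A.

(* This relation and the next definition make sense for arbitrary sets, and
   are used on convex polytopes. *)
Definition passes_through (R : realType) (P Q : set 'cV[R]_3) : Prop :=
  exists U : 'M[R]_3, exists eta delta : 'cV[R]_3,
    special_orthogonal U /\
    orth_proj eta @` [set U *m x + delta | x in P] `<=` orth_proj eta @` Q.

(* The supremum is taken in the extended reals because [sup] on [R] takes the
   default value 0 on unbounded sets. *)
Definition nieuwland_number (R : realType) (P : set 'cV[R]_3) : \bar R :=
  ereal_sup [set nu%:E | nu in
    [set nu : R | 1 <= nu /\ passes_through [set nu *: x | x in P] P]].

Definition cube (R : realType) : set 'cV[R]_3 :=
  [set x | forall i : 'I_3, `|x i 0| <= 1].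

(* [delta_mx i 0] is the standard basis vector e_i. *)
Definition octahedron (R : realType) : set 'cV[R]_3 :=
  convex_hull ([set delta_mx i 0 | i in [set: 'I_3]] `|`
               [set - delta_mx i 0 | i in [set: 'I_3]]).

(* Main.v *)
Require Import Defs.
From mathcomp Require Import all_boot all_order all_algebra.
From mathcomp Require Import all_classical all_reals all_analysis.
From mathcomp Require Import ring lra.

Set Implicit Arguments.
Unset Strict Implicit.
Unset Printing Implicit Defensive.

Import Order.TTheory GRing.Theory Num.Theory.

Local Open Scope classical_set_scope.
Local Open Scope ring_scope.

(** Transposing a matrix turns a passage of one solid into a passage of the
    other, so that the same factors nu are admissible for the cube C and for
    the octahedron O; the two suprema then run over the same set.

    Both solids are convex and symmetric, so a passage of nu C in C (and
    likewise for O) can be centered: it amounts to an orthogonal U and a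
    direction eta such that for every x in C some y in C has nu U x - y parallel
    to eta ([passage_centered]). Suppose that y can be chosen linearly in x, say
    y = M x. Then nu U = M + eta w for some row vector w ([similar_mod_rank1]),
    and M preserves the solid. Conversely such an M gives a passage along eta
    ([passage_of_matrix]). The relation nu U = M + eta w is stable under
    transposition, which exchanges eta and w ([similar_mod_rank1_tr]). Moreover
    M preserves C when its rows have l1-norm at most 1, and O when its columns
    do: the two solids are exchanged as well.

    It remains to find a linear lift. For O it is enough to lift the three
    vertices e_j ([col_bounded_of_octahedron_passage]). For C one uses that
    every projection of the cube contains a projected isometric copy of the
    square with vertices +-e_i +- e_j. Take eta of norm 1, let m = U^T eta, and
    let k be an index at which |m_k| is largest; the sign of eta is chosen so that m_k >= 0. The
    Householder reflection H that sends e_k to -m agrees modulo m with the matrix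
    D = 1 - e_k (m + e_k)^T / (1 + m_k), which kills e_k and maps C into C
    ([flattening_cube]). Hence nu U H agrees modulo eta with nu U D, and
    nu U D factors through the coordinate square, where it is enough to lift two
    adjacent vertices ([cube_lift]). *)

(** * The octahedron as a ball of the l1-norm *)

Lemma convex_set_lmodP (R : realType) (M : lmodType R) (K : set M) :
  @convex_set R M K <->
  forall (x y : M) (t : R), 0 <= t <= 1 -> K x -> K y ->
    K (t *: x + (1 - t) *: y).
Proof.
split=> [cK x y t t01 Kx Ky|cK x y t /set_mem Kx /set_mem Ky].
- case/andP: t01 => t0 t1.
  by have := cK x y (Itv01 t0 t1) (mem_set Kx) (mem_set Ky) => /set_mem.
- apply/mem_set; apply: cK => //.
  by apply/andP; split.
Qed.

(** The weights may sum to less than 1 because the missing mass goes to the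
    origin. *)
Lemma convex_combo_sub1 (R : realType) (M : lmodType R) (K : set M) (n : nat)
    (p : 'I_n -> R) (z : 'I_n -> M) :
  @convex_set R M K -> K 0 ->
  (forall i, 0 <= p i) -> \sum_i p i <= 1 -> (forall i, K (z i)) ->
  K (\sum_i p i *: z i).
Proof.
move=> /convex_set_lmodP cK K0 p0 p1 Kz.
(* The sum is written as (\sum_i p i) *: k with k in K; this form is stable
   under adding a term, without a separate case for a full weight. *)
suff [k [P0 [Kk ->]]] : exists k, 0 <= \sum_i p i /\ K k /\
    \sum_i p i *: z i = (\sum_i p i) *: k.
  have := cK k 0 (\sum_i p i); rewrite scaler0 addr0; apply=> //.
  by rewrite P0.
apply: (big_rec2 (fun v a => exists k, 0 <= a /\ K k /\ v = a *: k)).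
  by exists 0; rewrite scaler0.
move=> i v a _ [k [a0 [Kk ->]]].
have pa0 : 0 <= p i + a by rewrite addr_ge0.
have [pa|pa] := eqVneq (p i + a) 0.
  exists 0; split=> //; split=> //.
  have -> : p i = 0 by have := p0 i; lra.
  have -> : a = 0 by have := p0 i; lra.
  by rewrite !scale0r scaler0 addr0.
exists ((p i / (p i + a)) *: z i + (1 - p i / (p i + a)) *: k).
split=> //; split.
  apply: cK => //; rewrite divr_ge0 //=.
  by rewrite ler_pdivrMr ?mul1r ?lerDl // lt_neqAle eq_sym pa.
rewrite scalerDr !scalerA; congr (_ *: _ + _ *: _); field; exact: pa.
Qed.

Lemma octahedronE (R : realType) :
  @octahedron R = [set x | \sum_i `|x i 0| <= 1].
Proof.
apply/seteqP; split=> [|x /= x1].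
  apply: smallest_sub.
    apply/convex_set_lmodP => x y t /andP[t0 t1] /= x1 y1.
    apply: (@le_trans _ _ (\sum_i (t * `|x i 0| + (1 - t) * `|y i 0|))).
      apply: ler_sum => i _; rewrite !mxE (le_trans (ler_normD _ _)) //.
      by rewrite !normrM (ger0_norm t0) (ger0_norm (_ : 0 <= 1 - t)) ?subr_ge0.
    rewrite big_split -!mulr_sumr /=.
    by nra.
  have e1 i : \sum_j `|(delta_mx i 0 : 'cV[R]_3) j 0| <= 1.
    rewrite (bigD1 i) //= big1 ?addr0 ?mxE ?eqxx ?normr1 // => j ji.
    by rewrite mxE (negPf ji) normr0.
  move=> _ [[i _ <-]|[i _ <-]] //=.
  by under eq_bigr do rewrite mxE normrN.
move=> K [cK eK].
have K0 : K 0.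
  have := (@convex_set_lmodP _ _ _).1 cK (delta_mx 0 0) (- delta_mx 0 0) 2^-1.
  have -> : 1 - 2^-1 = 2^-1 :> R by lra.
  rewrite scalerN subrr; apply; first lra.
    by apply: eK; left; exists 0.
  by apply: eK; right; exists 0.
have -> : x = \sum_i `|x i 0| *: (Num.sg (x i 0) *: delta_mx i 0).
  rewrite {1}[x]matrix_sum_delta; apply: eq_bigr => i _.
  by rewrite big_ord1 scalerA mulrC -numEsg.
apply: convex_combo_sub1 => // i.
case: sgrP => _; rewrite ?scale0r ?scale1r ?scaleN1r //; apply: eK.
  by left; exists i.
by right; exists i.
Qed.

(** * Passages and matrices *)

Lemma dotv_gt0 (R : realType) (n : nat) (x : 'cV[R]_n) :
  x != 0 -> 0 < dotv x x.
Proof.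
move=> x0; have [i xi] : exists i, x i 0 != 0.
  apply/existsP; apply: contra_neqT x0 => /existsPn x0; apply/colP => i.
  by have /negbNE/eqP -> := x0 i; rewrite mxE.
rewrite /dotv (bigD1 i) //= ltr_pwDl //.
  by rewrite -expr2 exprn_even_gt0.
by apply: sumr_ge0 => j _; rewrite -expr2 sqr_ge0.
Qed.

Lemma orth_proj_eqP (R : realType) (eta x y : 'cV[R]_3) :
  orth_proj eta x = orth_proj eta y <-> exists c, x = y + c *: eta.
Proof.
rewrite /orth_proj; case: (eqVneq eta 0) => [->|eta0].
  split=> [->|[c ->]]; last by rewrite scaler0 addr0.
  by exists 0; rewrite scaler0 addr0.
have ee : dotv eta eta != 0 by rewrite gt_eqF // dotv_gt0.
split=> [e|[c ->]].
  exists (dotv x eta / dotv eta eta - dotv y eta / dotv eta eta).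
  by rewrite scalerBl addrCA -e addrC subrK.
have -> : dotv (y + c *: eta) eta = dotv y eta + c * dotv eta eta.
  rewrite /dotv mulr_sumr -big_split; apply: eq_bigr => i _.
  by rewrite !mxE mulrDl mulrA.
by rewrite mulrDl mulfK // scalerDl opprD addrACA subrr addr0.
Qed.

(** Modulo the line spanned by eta, M acts as nu times an isometry. *)
Definition similar_mod_rank1 (R : realType) (n : nat) (nu : R) (M : 'M[R]_n)
    : Prop :=
  exists (U : 'M[R]_n) (eta : 'cV[R]_n) (w : 'rV[R]_n),
    U *m U^T = 1%:M /\ nu *: U = M + eta *m w.

(** The direction eta of projection and the row w of corrections exchange their
    roles; this is the source of the duality between the two solids. *)
Lemma similar_mod_rank1_tr (R : realType) (n : nat) (nu : R) (M : 'M[R]_n) :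
  similar_mod_rank1 nu M -> similar_mod_rank1 nu M^T.
Proof.
move=> [U [eta [w [UU UM]]]]; exists U^T, w^T, eta^T; split.
  by rewrite trmxK; apply: mulmx1C.
by rewrite -linearZ /= UM linearD /= trmx_mul.
Qed.

(** A factor U of determinant -1 is harmless: the symmetry of P allows to replace
    U by - U, which is a rotation in dimension 3. *)
Lemma passage_of_matrix (R : realType) (P : set 'cV[R]_3) (nu : R)
    (M : 'M[R]_3) :
  (forall x, P x -> P (- x)) -> (forall x, P x -> P (M *m x)) ->
  similar_mod_rank1 nu M -> passes_through [set nu *: x | x in P] P.
Proof.
move=> PN PM [U [eta [w [UU UM]]]].
have M_shadow x : nu *: (U *m x) = M *m x + (w *m x) 0 0 *: eta.
  by rewrite scalemxAl UM mulmxDl -mulmxA {1}[w *m x]mx11_scalar mul_mx_scalar.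
have /eqP : \det U ^+ 2 = 1 by rewrite expr2 -{2}det_tr -det_mulmx UU det1.
rewrite sqrf_eq1 => /orP[]/eqP detU.
- exists U, eta, 0; split=> // _ [_ [_ [x Px <-] <-] <-].
  exists (M *m x); first exact: PM.
  apply/esym/orth_proj_eqP; exists ((w *m x) 0 0).
  by rewrite addr0 -scalemxAr M_shadow.
- exists (- U), eta, 0; split.
    split; first by rewrite linearN /= mulNmx mulmxN opprK.
    by rewrite -scaleN1r detZ detU -signr_odd /= expr1 mulrNN mulr1.
  move=> _ [_ [_ [x Px <-] <-] <-].
  exists (M *m (- x)); first by apply/PM/PN.
  apply/esym/orth_proj_eqP; exists ((w *m (- x)) 0 0).
  by rewrite addr0 -M_shadow -scalemxAr mulmxN mulNmx.
Qed.

(** The translation disappears by averaging the lift of x with the opposite of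
    the lift of - x. A passage without projection is also a passage along
    any direction, which is why eta can be taken of norm 1. *)
Lemma passage_centered (R : realType) (P Q : set 'cV[R]_3) (nu : R) :
  (forall x, P x -> P (- x)) ->
  (forall y z, Q y -> Q z -> Q (2^-1 *: (y - z))) ->
  passes_through [set nu *: x | x in P] Q ->
  exists U eta, [/\ U *m U^T = 1%:M, dotv eta eta = 1 &
    forall x, P x -> exists y c, Q y /\ nu *: (U *m x) = y + c *: eta].
Proof.
move=> PN Qmid [U [eta [delta [[UU _] sub]]]].
have {}sub x : P x -> exists y c, Q y /\ nu *: (U *m x) = y + c *: eta.
  have lift z : P z ->
      exists y c, Q y /\ nu *: (U *m z) + delta = y + c *: eta.
    move=> Pz; have [|y Qy /esym/orth_proj_eqP[c e]] :=
      sub (orth_proj eta (U *m (nu *: z) + delta)).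
      by exists (U *m (nu *: z) + delta) => //; exists (nu *: z) => //; exists z.
    by exists y, c; split=> //; rewrite scalemxAr.
  move=> Px; have [y [c [Qy ey]]] := lift _ Px.
  have [z [d [Qz ez]]] := lift _ (PN _ Px).
  exists (2^-1 *: (y - z)), (2^-1 * (c - d)); split; first exact: Qmid.
  apply/colP => i; move/colP/(_ i): ey; move/colP/(_ i): ez.
  rewrite mulmxN !mxE; lra.
have [eta0|eta0] := eqVneq eta 0.
  exists U, (delta_mx 0 0); split=> //.
    by rewrite /dotv (bigD1 0) //= big1 ?mxE ?addr0 ?mulr1 // => i /negPf i0;
      rewrite mxE i0 mul0r.
  move=> x /sub[y [c [Qy ->]]]; exists y, 0; split=> //.
  by rewrite eta0 !(scaler0, scale0r).
have ee := dotv_gt0 eta0.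
set s := Num.sqrt (dotv eta eta).
have s0 : s != 0 by rewrite gt_eqF // sqrtr_gt0.
exists U, (s^-1 *: eta); split=> //.
  have -> : dotv (s^-1 *: eta) (s^-1 *: eta) = s^-1 ^+ 2 * dotv eta eta.
    rewrite /dotv mulr_sumr; apply: eq_bigr => i _; rewrite !mxE; ring.
  by rewrite -[dotv _ _]sqr_sqrtr ?ltW // -/s exprVn mulVf // expf_neq0.
move=> x /sub[y [c [Qy ->]]]; exists y, (c * s); split=> //.
by rewrite scalerA mulfK.
Qed.

(** * Matrices preserving the two solids *)

Lemma cubeN (R : realType) (x : 'cV[R]_3) : cube x -> cube (- x).
Proof. by move=> Cx i; rewrite mxE normrN. Qed.

Lemma cube_half_sub (R : realType) (x y : 'cV[R]_3) :
  cube x -> cube y -> cube (2^-1 *: (x - y)).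
Proof.
move=> Cx Cy i; have := Cx i; have := Cy i.
by rewrite !mxE !ler_norml => /andP[? ?] /andP[? ?]; lra.
Qed.

Lemma octahedronN (R : realType) (x : 'cV[R]_3) :
  octahedron x -> octahedron (- x).
Proof.
by rewrite octahedronE /=; under [X in _ -> X <= _]eq_bigr do rewrite mxE normrN.
Qed.

Lemma octahedron_half_sub (R : realType) (x y : 'cV[R]_3) :
  octahedron x -> octahedron y -> octahedron (2^-1 *: (x - y)).
Proof.
rewrite octahedronE /= => Ox Oy.
apply: (@le_trans _ _ (\sum_i 2^-1 * (`|x i 0| + `|y i 0|))).
  apply: ler_sum => i _; rewrite !mxE normrM gtr0_norm ?invr_gt0 //.
  by rewrite ler_wpM2l ?invr_ge0 // ler_normB.
rewrite -mulr_sumr big_split /=; lra.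
Qed.

Lemma octahedron_delta (R : realType) (j : 'I_3) :
  octahedron (delta_mx j 0 : 'cV[R]_3).
Proof. by apply: sub_gen_smallest; left; exists j. Qed.

Definition row_bounded (R : realType) (n : nat) (M : 'M[R]_n) : Prop :=
  forall i, \sum_j `|M i j| <= 1.

Lemma row_bounded_cube (R : realType) (M : 'M[R]_3) (x : 'cV[R]_3) :
  row_bounded M -> cube x -> cube (M *m x).
Proof.
move=> M1 Cx i; rewrite mxE (le_trans (ler_norm_sum _ _ _)) //.
apply: le_trans (M1 i); apply: ler_sum => j _.
by rewrite normrM ler_piMr.
Qed.

Lemma col_bounded_octahedron (R : realType) (M : 'M[R]_3) (x : 'cV[R]_3) :
  row_bounded M^T -> octahedron x -> octahedron (M *m x).
Proof.
rewrite octahedronE /= => M1; apply: le_trans.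
apply: (@le_trans _ _ (\sum_i \sum_j `|M i j| * `|x j 0|)).
  apply: ler_sum => i _; rewrite mxE (le_trans (ler_norm_sum _ _ _)) //.
  by apply: ler_sum => j _; rewrite normrM.
rewrite exchange_big; apply: ler_sum => j _ /=.
rewrite -mulr_suml ler_piMl //; apply: le_trans (M1 j).
by apply: ler_sum => i _; rewrite mxE.
Qed.

(** * Linear lifts of passages *)

(** The lift is linear for free: the basis vectors are vertices of the
    octahedron, and lifting them independently determines M. *)
Lemma col_bounded_of_octahedron_passage (R : realType) (nu : R) :
  passes_through [set nu *: x | x in @octahedron R] (@octahedron R) ->
  exists M : 'M[R]_3, similar_mod_rank1 nu M /\ row_bounded M^T.
Proof.
move=> /(passage_centered (@octahedronN R) (@octahedron_half_sub R)).
move=> [U [eta [UU _ lift]]].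
have /choice[y] : forall j : 'I_3, exists y, exists c, octahedron y /\
    nu *: (U *m delta_mx j 0) = y + c *: eta.
  by move=> j; apply: lift; apply: octahedron_delta.
move=> /choice[c yc].
exists (\matrix_(i, j) y j i 0); split.
  exists U, eta, (\row_j c j); split=> //.
  apply/matrixP => i j; have [_ /colP/(_ i)] := yc j.
  by rewrite -colE !mxE big_ord1 !mxE => ->; rewrite [eta _ _ * _]mulrC.
move=> j; have [+ _] := yc j; rewrite octahedronE /=.
by apply: le_trans; apply: ler_sum => i _; rewrite !mxE.
Qed.

(** Naming the two indices other than k spares a case analysis on k later. *)
Lemma sum_I3 (k : 'I_3) : exists i j, [/\ i != k, j != k, i != j &
  forall (V : zmodType) (F : 'I_3 -> V), \sum_l F l = F i + F j + F k].
Proof.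
pose o1 : 'I_3 := @Ordinal 3 1 isT; pose o2 : 'I_3 := @Ordinal 3 2 isT.
have sum3 (V : zmodType) (F : 'I_3 -> V) : \sum_l F l = F ord0 + F o1 + F o2.
  rewrite 3!big_ord_recl big_ord0 addr0 addrA.
  by congr (F _ + F _ + F _); apply: val_inj.
case: k => [[|[|[|//]]] kP].
- exists o1, o2; split=> // V F; rewrite sum3 [F ord0 + _]addrC addrAC.
  by congr (_ + F _); apply: val_inj.
- exists ord0, o2; split=> // V F; rewrite sum3 addrAC.
  by congr (_ + F _); apply: val_inj.
- exists ord0, o1; split=> // V F; rewrite sum3.
  by congr (_ + F _); apply: val_inj.
Qed.

(** For a unit vector m, [1%:M + (m + delta_mx k 0) *m reflection_row m k] is the
    Householder reflection that exchanges delta_mx k 0 and - m. *)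
Definition reflection_row (R : realType) (n : nat) (m : 'cV[R]_n) (k : 'I_n)
    : 'rV[R]_n :=
  - (1 + m k 0)^-1 *: (m + delta_mx k 0)^T.

Lemma householder_orthogonal (R : realType) (n : nat) (m : 'cV[R]_n)
    (k : 'I_n) :
  dotv m m = 1 -> 0 <= m k 0 ->
  let H := 1%:M + (m + delta_mx k 0) *m reflection_row m k in H *m H^T = 1%:M.
Proof.
move=> m1 mk0 H; rewrite /H /reflection_row.
set v := m + _; set q := (1 + m k 0)^-1.
have vv : v^T *m v = (2 * (1 + m k 0))%:M.
  rewrite [LHS]mx11_scalar mxE; congr (_%:M).
  have -> : 2 * (1 + m k 0) = dotv m m + (2 * m k 0 + 1) by rewrite m1; ring.
  have -> : 2 * m k 0 + 1 = \sum_i (i == k)%:R * (2 * m i 0 + 1).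
    rewrite (bigD1 k) //= eqxx mul1r big1 ?addr0 // => i /negPf ->.
    by rewrite mul0r.
  rewrite /dotv -big_split; apply: eq_bigr => i _; rewrite !mxE andbT /=.
  by case: (i == k) => /=; ring.
have q0 : 1 + m k 0 != 0 by rewrite gt_eqF // ltr_pwDl.
have HT : (1%:M + v *m (- q *: v^T))^T = 1%:M + v *m (- q *: v^T).
  by rewrite linearD /= trmx1 trmx_mul linearZ /= trmxK -scalemxAl -scalemxAr.
rewrite HT mulmxDl mul1mx mulmxDr mulmx1 mulmxA.
rewrite -[X in _ + (_ + X *m _)]mulmxA -[_ *: _ *m v]scalemxAl vv.
rewrite scale_scalar_mx mul_mx_scalar -scalemxAl.
rewrite -[RHS]addr0 -addrA; congr (_ + _).
rewrite -[X in X + (X + _)]scale1r -!scalerDl /q.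
rewrite [X in X *: _](_ : _ = 0) ?scale0r //.
field; exact: q0.
Qed.

(** The Householder reflection above, reduced modulo m: the two matrices differ by
    [m *m reflection_row m k]. *)
Definition flattening (R : realType) (n : nat) (m : 'cV[R]_n) (k : 'I_n)
    : 'M[R]_n :=
  1%:M + delta_mx k 0 *m reflection_row m k.

Lemma flattening_kill (R : realType) (n : nat) (m : 'cV[R]_n) (k : 'I_n) :
  0 <= m k 0 -> flattening m k *m delta_mx k 0 = 0 :> 'cV_n.
Proof.
rewrite /flattening => mk0; have q0 : 1 + m k 0 != 0 by rewrite gt_eqF // ltr_pwDl.
rewrite mulmxDl mul1mx -mulmxA [reflection_row m k *m _]mx11_scalar -colE !mxE.
rewrite !eqxx [m k 0 + _]addrC mulNr mulVf // mul_mx_scalar scaleN1r.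
by rewrite addrN.
Qed.

(** Every projection of the cube contains a unit square: the image of the cube
    under the flattening agrees modulo m with an isometric copy of the
    coordinate square orthogonal to delta_mx k 0. Only coordinate k of x
    changes; it becomes - (m i * x i + m j * x j) / (1 + m k), with i, j the other
    indices, and |m i| <= m k, |m j| <= 1. *)
Lemma flattening_cube (R : realType) (m : 'cV[R]_3) (k : 'I_3) (x : 'cV[R]_3) :
  dotv m m = 1 -> 0 <= m k 0 -> (forall i, `|m i 0| <= m k 0) -> cube x ->
  cube (flattening m k *m x).
Proof.
rewrite /flattening => m1 mk0 mk Cx l.
rewrite mulmxDl mul1mx -mulmxA [reflection_row m k *m _]mx11_scalar mul_mx_scalar.
rewrite !mxE andbT; have [->|lk] := eqVneq l k; last first.
  by rewrite mulr0 addr0.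
have [i [j [ik jk _ sumE]]] := sum_I3 k.
have q0 : 0 < 1 + m k 0 by rewrite ltr_pwDl.
have mj : `|m j 0| <= 1.
  rewrite -ler_sqr ?nnegrE // expr1n real_normK ?num_real // -m1 /dotv sumE -!expr2.
  by have := sqr_ge0 (m i 0); have := sqr_ge0 (m k 0); lra.
rewrite sumE !mxE !eqxx (negPf ik) (negPf jk) /= !addr0 mulr1.
rewrite [X in `|X|](_ : _ = - ((m i 0 * x i 0 + m j 0 * x j 0) / (1 + m k 0)));
  last by field; exact: lt0r_neq0.
rewrite normrN normrM normfV (gtr0_norm q0) ler_pdivrMr // mul1r.
rewrite (le_trans (ler_normD _ _)) // addrC lerD // normrM.
  by rewrite (le_trans _ mj) // ler_piMr.
by rewrite (le_trans _ (mk i)) // ler_piMr.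
Qed.

(** A map that kills delta_mx k 0 sees the cube as a square with vertices
    +-e_i +- e_j. If y and z lift the images of the vertices e_i + e_j and e_i - e_j,
    the matrix M sends e_i to (y + z) / 2 and e_j to (y - z) / 2. Its rows have
    l1-norm at most 1, because |a + b| + |a - b| = 2 max(|a|, |b|). *)
Lemma cube_lift (R : realType) (L : 'M[R]_3) (eta : 'cV[R]_3) (k : 'I_3) :
  L *m delta_mx k 0 = 0 :> 'cV_3 ->
  (forall x, cube x -> exists y c, cube y /\ L *m x = y + c *: eta) ->
  exists M w, row_bounded M /\ L = M + eta *m w.
Proof.
move=> Lk lift; have [i [j [ik jk ij sumE]]] := sum_I3 k.
pose e l : 'cV[R]_3 := delta_mx l 0.
have e1 : e i *m (e i)^T + e j *m (e j)^T + e k *m (e k)^T = 1%:M.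
  rewrite -(sumE _ (fun l => e l *m (e l)^T)) [RHS]mx1_sum_delta.
  by apply: eq_bigr => l _; rewrite /e trmx_delta mul_delta_mx.
have Ce (b : R) : `|b| <= 1 -> cube (e i + b *: e j).
  move=> b1 l; rewrite !mxE !andbT; case: (eqVneq l i) => [->|_].
    by rewrite (negPf ij) mulr0 addr0 normr1.
  rewrite add0r; case: (l == j); first by rewrite mulr1.
  by rewrite mulr0 normr0.
have [|y [c [Cy ey]]] := lift (e i + 1 *: e j).
  by apply: Ce; rewrite normr1.
have [|z [d [Cz ez]]] := lift (e i + (-1) *: e j).
  by apply: Ce; rewrite normrN1.
have Lei : L *m e i = 2^-1 *: (y + z) + eta *m (2^-1 * (c + d))%:M.
  have -> : e i = 2^-1 *: ((e i + 1 *: e j) + (e i + (-1) *: e j)).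
    by apply/colP => l; rewrite !mxE; field.
  rewrite -scalemxAr mulmxDr ey ez mul_mx_scalar; apply/colP => l.
  by rewrite !mxE; field.
have Lej : L *m e j = 2^-1 *: (y - z) + eta *m (2^-1 * (c - d))%:M.
  have -> : e j = 2^-1 *: ((e i + 1 *: e j) - (e i + (-1) *: e j)).
    by apply/colP => l; rewrite !mxE; field.
  rewrite -scalemxAr mulmxBr ey ez mul_mx_scalar; apply/colP => l.
  by rewrite !mxE; field.
exists (2^-1 *: (y + z) *m (e i)^T + 2^-1 *: (y - z) *m (e j)^T).
exists ((2^-1 * (c + d))%:M *m (e i)^T + (2^-1 * (c - d))%:M *m (e j)^T); split.
  move=> l; rewrite sumE !mxE !big_ord1 !mxE !eqxx.
  rewrite [j == i]eq_sym ![k == _]eq_sym (negPf ij) (negPf ik) (negPf jk) /=.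
  rewrite !(mulr0, mulr1, addr0, add0r) normr0 addr0.
  have := Cy l; have := Cz l; rewrite !ler_norml => /andP[? ?] /andP[? ?].
  by case: (ler0P (2^-1 * (y l 0 + z l 0)));
    case: (ler0P (2^-1 * (y l 0 - z l 0))); lra.
rewrite -[LHS]mulmx1 -e1 !mulmxDr !mulmxA Lei Lej Lk mul0mx addr0 !mulmxDl.
by rewrite addrACA.
Qed.

(** The isometry obtained is not the given U but U H, with H the Householder
    reflection for m = U^T eta: this turns the square seen by the flattening into
    the square contained in the projection of U C. *)
Lemma row_bounded_of_cube_passage (R : realType) (nu : R) :
  passes_through [set nu *: x | x in @cube R] (@cube R) ->
  exists M : 'M[R]_3, similar_mod_rank1 nu M /\ row_bounded M.
Proof.
move=> /(passage_centered (@cubeN R) (@cube_half_sub R)).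
move=> [U [eta [UU eta1 lift]]].
have dotvE (x y : 'cV[R]_3) : dotv x y = (x^T *m y) 0 0.
  by rewrite mxE; apply: eq_bigr => i _; rewrite mxE.
have [k mk] : exists k, forall i, `|(U^T *m eta) i 0| <= `|(U^T *m eta) k 0|.
  case: (Order.TotalTheory.arg_maxP (i0 := 0)
           (fun i => `|(U^T *m eta) i 0|) (isT : predT 0)) => k _ mk.
  by exists k => i; apply: mk.
(* The denominator 1 + m k has to be positive; changing the sign of eta, and
   hence of m, costs nothing. *)
wlog mk0 : eta eta1 lift mk / 0 <= (U^T *m eta) k 0.
  move=> wl; have [mk0|mk0] := leP 0 ((U^T *m eta) k 0); first exact: wl mk0.
  have mN l : (U^T *m - eta) l 0 = - (U^T *m eta) l 0 by rewrite mulmxN mxE.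
  apply: (wl (- eta)).
  - by rewrite -eta1; apply: eq_bigr => i _; rewrite !mxE mulrNN.
  - move=> x /lift[y [c [Cy e]]]; exists y, (- c); split=> //.
    by rewrite scaleNr scalerN opprK.
  - by move=> i; rewrite !mN !normrN.
  - by rewrite mN oppr_ge0 ltW.
set m := U^T *m eta in mk mk0.
have m1 : dotv m m = 1.
  by rewrite dotvE /m trmx_mul trmxK mulmxA -[_ *m U *m _]mulmxA UU mulmx1 -dotvE.
have {}mk i : `|m i 0| <= m k 0 by rewrite -[leRHS]ger0_norm.
pose h := reflection_row m k.
have [||M [w [M1 LM]]] := @cube_lift R (nu *: (U *m flattening m k)) eta k.
- by rewrite -scalemxAl -mulmxA flattening_kill // mulmx0 scaler0.
- move=> x Cx; rewrite -scalemxAl -mulmxA; apply/lift.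
  exact: flattening_cube.
exists M; split=> //.
exists (U *m (1%:M + (m + delta_mx k 0) *m h)), eta, (w + nu *: h); split.
  rewrite trmx_mul mulmxA -[U *m _ *m _]mulmxA householder_orthogonal //.
  by rewrite mulmx1.
have -> : 1%:M + (m + delta_mx k 0) *m h = flattening m k + m *m h.
  by rewrite mulmxDl addrCA addrC.
rewrite [U *m _]mulmxDr scalerDr LM mulmxA /m mulmxA UU mul1mx.
by rewrite mulmxDr -(scalemxAr nu) addrA.
Qed.

(** * Duality *)

Lemma cube_passage_iff_octahedron_passage (R : realType) (nu : R) :
  passes_through [set nu *: x | x in @cube R] (@cube R) <->
  passes_through [set nu *: x | x in @octahedron R] (@octahedron R).
Proof.
split=> [/row_bounded_of_cube_passage|/col_bounded_of_octahedron_passage].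
- move=> [M [/similar_mod_rank1_tr simM M1]].
  apply: passage_of_matrix simM; first exact: octahedronN.
  by move=> x; apply: col_bounded_octahedron; rewrite trmxK.
- move=> [M [/similar_mod_rank1_tr simM M1]].
  apply: passage_of_matrix simM; first exact: cubeN.
  by move=> x; apply: row_bounded_cube.
Qed.

Theorem theorem14 (R : realType) :
  nieuwland_number (@cube R) = nieuwland_number (@octahedron R).
Proof.
rewrite /nieuwland_number; congr (ereal_sup [set _%:E | _ in _]).
by apply/seteqP; split=> nu /= [nu1 /cube_passage_iff_octahedron_passage].
Qed.
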